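(* Let $S=\mathbb{C}[x_1,\ldots,x_n]$, let $k\geqslant 1$, and let $X=X_1\cup\ldots\cup X_s$ be an equidimensional subspace arrangement of codimension $k$ in $\mathbb{C}^n$ such that for all $i\in\{1,\ldots,s\}$, $X_i$ is a vector subspace (of codimension $k$) defined by the regular sequence $(h_{i,1},\ldots,h_{i,k})$ in $S$. If $s\leqslant\binom{n}{k}$ and $X$ is a generic subspace arrangement, then $X$ is free.
   Context: Here $n\in\mathbb{N}_{\geqslant 1}$ and $S=\mathbb{C}[x_1,\ldots,x_n]$. $\mathrm{Der}_{\mathbb{C}^n}$ is the $S$-module of vector fields on $\mathbb{C}^n$, free of rank $n$ with basis $\partial_{x_1},\ldots,\partial_{x_n}$; $\Omega^q_{\mathbb{C}^n}$ is the $S$-module of differential $q$-forms; $\langle\cdot,\cdot\rangle:\bigwedge^q\mathrm{Der}_{\mathbb{C}^n}\times\Omega^q_{\mathbb{C}^n}\to S$ is the usual pairing. For an equidimensional subspace $X\subseteq\mathbb{C}^n$ of codimension $k$ defined as the vanishing set of the radical ideal $I_X\subseteq S$, the module of multi-logarithmic $k$-vector fields along $X$ is $$\mathrm{Der}^k(-\log X)=\left\{\delta\in\bigwedge^k\mathrm{Der}_{\mathbb{C}^n}\ \middle|\ \forall f_1,\ldots,f_k\in I_X,\ \langle\delta,df_1\wedge\dots\wedge df_k\rangle\in I_X\right\}.$$ An equidimensional reduced subspace $X\subseteq\mathbb{C}^n$ of codimension $k$ is called free if the projective dimension of the $S$-module $\mathrm{Der}^k(-\log X)$ equals $k-1$.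 An equidimensional subspace arrangement of codimension $k$ in $\mathbb{C}^n$ is a finite union of pairwise distinct vector subspaces of codimension $k$ of $\mathbb{C}^n$; $I_X$ denotes the radical ideal of polynomials vanishing on $X$. That the vector subspace $X_i$ is defined by $(h_{i,1},\ldots,h_{i,k})$ means $I_{X_i}=\langle h_{i,1},\ldots,h_{i,k}\rangle$. An element $\delta=\sum_{|E|=k}a_E\bigwedge_{i\in E}\partial_{x_i}$ (sum over subsets $E\subseteq\{1,\ldots,n\}$ of size $k$) of $\bigwedge^k\mathrm{Der}_{\mathbb{C}^n}$ is homogeneous of degree $p$ if all $a_E\in S$ are homogeneous polynomials of degree $p$; for a graded module $M$, $M_p$ denotes the set of its homogeneous elements of degree $p$. An equidimensional subspace arrangement $X=\bigcup_{i\in\Lambda}X_i$ of codimension $k$ in $\mathbb{C}^n$ ($\Lambda$ finite) is called generic if for $j=\min\{|\Lambda|,\binom{n}{k}\}$ and all $I\subseteq\Lambda$ with $|I|=j$, $$\dim_{\mathbb{C}}\left(\bigcap_{i\in I}\mathrm{Der}^k(-\log X_i)_0\right)=\binom{n}{k}-j.$$ *)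

(* Defs.v *)
From HB Require Import structures.
From mathcomp Require Import all_boot all_order all_algebra.
From mathcomp Require Import boolp classical_sets reals.
From mathcomp Require Import complex.
From mathcomp Require Import mpoly.

Set Implicit Arguments.
Unset Strict Implicit.
Unset Printing Implicit Defensive.

Import GRing.Theory.
Local Open Scope ring_scope.

Definition projective (S : nzRingType) (P : lmodType S) : Prop :=
  forall (A B : lmodType S) (g : {linear A -> B}) (f : {linear P -> B}),
    (forall b, exists a, g a = b) ->
    exists f' : {linear P -> A}, forall x, g (f' x) = f x.

Record proj_resolution (S : nzRingType) (M : lmodType S) := ProjResolution {
  pr_mod : nat -> lmodType S;
  pr_diff : forall i, {linear pr_mod i.+1 -> pr_mod i};
  pr_aug : {linear pr_mod 0 -> M};
  pr_projective : forall i, projective (pr_mod i);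
  pr_aug_surj : forall m, exists x, pr_aug x = m;
  pr_exact0 : forall x, pr_aug x = 0 <-> exists y, pr_diff 0 y = x;
  pr_exact : forall i x,
    pr_diff i x = 0 <-> exists y, pr_diff i.+1 y = x
}.

Definition has_proj_resolution (S : nzRingType) (M : lmodType S) (d : nat) :=
  exists P : proj_resolution M,
    forall i, (d < i)%N -> forall x : pr_mod P i, x = 0.

(** With the convention that the zero module has projective dimension
    [-oo], only a nonzero module can have projective dimension [d : nat]. *)
Definition proj_dim_eq (S : nzRingType) (M : lmodType S) (d : nat) : Prop :=
  [/\ exists x : M, x != 0,
      has_proj_resolution M d
    & forall e, (e < d)%N -> ~ has_proj_resolution M e].

Definition in_ideal (S : comNzRingType) (s : seq S) (f : S) : Prop :=
  exists c : nat -> S, f = \sum_(i < size s) c i * s`_i.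

Definition regular_seq (S : comNzRingType) (s : seq S) : Prop :=
  (forall j, (j < size s)%N ->
     forall g, in_ideal (take j s) (g * s`_j) -> in_ideal (take j s) g)
  /\ ~ in_ideal s 1.

Definition vanishing_ideal (F : fieldType) (n : nat) (X : set 'rV[F]_n) :
    set {mpoly F[n]} :=
  fun f => forall x, X x -> f.@[fun i => x 0 i] = 0.

Definition ksubset (n k : nat) := {E : {set 'I_n} | #|E| == k}.

(** The [j]-th smallest element of [E]. *)
Definition ksubset_nth (n k : nat) (E : ksubset n k) (j : 'I_k) : 'I_n :=
  enum_val (cast_ord (esym (eqP (valP E))) j).

(** [a] stands for the sum over [E = {e_1 < ... < e_k}] of
    [a E * d/dx_{e_1} /\ ... /\ d/dx_{e_k}]. *)
Notation kvector_field F n k := {ffun ksubset n k -> {mpoly F[n]}^o}.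

(** Likewise with the basis [dx_{e_1} /\ ... /\ dx_{e_k}]. *)
Notation kform F n k := {ffun ksubset n k -> {mpoly F[n]}^o} (only parsing).

(** The coordinates of [df] in the basis [dx_1, ..., dx_n]. *)
Definition ext_d (F : fieldType) (n : nat) (f : {mpoly F[n]}) :
    'rV[{mpoly F[n]}]_n :=
  \row_i f^`M(i).

(** The coefficient of [w_1 /\ ... /\ w_k] on [dx_E] is the minor of the
    coefficients of the [w_i] with columns in [E]. *)
Definition wedge (F : fieldType) (n k : nat)
    (w : 'I_k -> 'rV[{mpoly F[n]}]_n) : kform F n k :=
  [ffun E => \det (\matrix_(i < k, j < k) w i 0 (ksubset_nth E j))].

(** The two bases above are dual to each other for the usual pairing. *)
Definition pairing (F : fieldType) (n k : nat)
    (a : kvector_field F n k) (w : kform F n k) : {mpoly F[n]} :=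
  \sum_E (a E : {mpoly F[n]}) * w E.

Definition kvf_homog (F : fieldType) (n k p : nat)
    (a : kvector_field F n k) : Prop :=
  forall E, (a E : {mpoly F[n]}) \is p.-homog.

Definition is_mlog (F : fieldType) (n k : nat) (X : set 'rV[F]_n)
    (a : kvector_field F n k) : Prop :=
  forall f : 'I_k -> {mpoly F[n]},
    (forall i, vanishing_ideal X (f i)) ->
    vanishing_ideal X (pairing a (wedge (fun i => ext_d (f i)))).

Definition mlog_pred (F : fieldType) (n k : nat) (X : set 'rV[F]_n) :
    {pred kvector_field F n k} :=
  fun a => `[< is_mlog X a >].

Fact mlog_submod_closed (F : fieldType) (n k : nat) (X : set 'rV[F]_n) :
  submod_closed (@mlog_pred F n k X).
Proof.
split=> [|c a b /asboolP ha /asboolP hb]; apply/asboolP => f hf x Xx.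
  by rewrite /pairing big1 ?meval0 // => E _; rewrite ffunE mul0r.
have -> w : pairing (c *: a + b) w = c * pairing a w + pairing b w.
  rewrite /pairing big_distrr -big_split /=; apply: eq_bigr => E _.
  by rewrite !ffunE mulrDl mulrA.
by rewrite mevalD mevalM (ha f hf x Xx) (hb f hf x Xx) mulr0 addr0.
Qed.

HB.instance Definition _ (F : fieldType) (n k : nat) (X : set 'rV[F]_n) :=
  GRing.isSubmodClosed.Build {mpoly F[n]} (kvector_field F n k)
    (@mlog_pred F n k X) (@mlog_submod_closed F n k X).

(** The [S]-module [Der^k(-log X)], where [S] is [{mpoly F[n]}]. *)
Record mlog (F : fieldType) (n k : nat) (X : set 'rV[F]_n) := MLog {
  mlog_val :> kvector_field F n k;
  mlog_valP : mlog_val \in @mlog_pred F n k X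
}.
Arguments mlog {F n} k X.

HB.instance Definition _ (F : fieldType) (n k : nat) (X : set 'rV[F]_n) :=
  [isSub for @mlog_val F n k X].
HB.instance Definition _ (F : fieldType) (n k : nat) (X : set 'rV[F]_n) :=
  [Choice of mlog k X by <:].
HB.instance Definition _ (F : fieldType) (n k : nat) (X : set 'rV[F]_n) :=
  [SubChoice_isSubLmodule of mlog k X by <:].

(** Freeness, for [X] reduced and equidimensional of codimension [k >= 1]. *)
Definition mlog_free (F : fieldType) (n k : nat) (X : set 'rV[F]_n) : Prop :=
  proj_dim_eq (mlog k X) k.-1.

Definition vspace_set (F : fieldType) (n : nat) (U : {vspace 'rV[F]_n}) :
    set 'rV[F]_n :=
  fun x => x \in U.

Definition subspace_arrangement (F : fieldType) (n k : nat) (L : finType)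
    (X : L -> {vspace 'rV[F]_n}) : Prop :=
  injective X /\ forall i, (\dim (X i) + k)%N = n.

Definition arrangement_set (F : fieldType) (n : nat) (L : finType)
    (X : L -> {vspace 'rV[F]_n}) : set 'rV[F]_n :=
  fun x => exists i, vspace_set (X i) x.

Definition defined_by (F : fieldType) (n : nat) (U : {vspace 'rV[F]_n})
    (h : seq {mpoly F[n]}) : Prop :=
  forall f, vanishing_ideal (vspace_set U) f <-> in_ideal h f.

(** The dimension is taken over [F], not over [{mpoly F[n]}]: the
    coefficients of the linear combinations are constants. *)
Definition has_dim (F : fieldType) (n k : nat)
    (W : set (kvector_field F n k)) (d : nat) : Prop :=
  exists b : 'I_d -> kvector_field F n k,
    (forall c : 'I_d -> F,
       \sum_i (c i)%:MP *: b i = 0 -> forall i, c i = 0) /\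
    (forall a, W a <-> exists c : 'I_d -> F, a = \sum_i (c i)%:MP *: b i).

Definition generic (F : fieldType) (n k : nat) (L : finType)
    (X : L -> {vspace 'rV[F]_n}) : Prop :=
  let j := minn #|L| 'C(n, k) in
  forall I : {set L}, #|I| = j ->
    has_dim (fun a : kvector_field F n k =>
               (forall i, i \in I -> is_mlog (vspace_set (X i)) a) /\
               kvf_homog 0 a)
      ('C(n, k) - j).

(* Main.v *)
Require Import Defs.
From HB Require Import structures.
From mathcomp Require Import all_boot all_order all_algebra.
From mathcomp Require Import boolp classical_sets reals.
From mathcomp Require Import complex.
From mathcomp Require Import mpoly.

Set Implicit Arguments.
Unset Strict Implicit.
Unset Printing Implicit Defensive.

Import GRing.Theory.
Local Open Scope ring_scope.

(** Let the subspace [X_i] be cut out by the rows of a matrix [L_i], and let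
    [alpha_i] be the constant [k]-form whose coordinates are the maximal minors
    of [L_i].  If [f_1, ..., f_k] vanish on [X_i] then, at a point of [X_i], the
    [df_m] vanish on the tangent space [X_i], hence are combinations of the rows
    of [L_i], and [df_1 /\ ... /\ df_k] is a multiple of [alpha_i].  Conversely,
    some polynomial [g] vanishes on every [X_j] with [j != i] but not on [X_i];
    the [g l_m], with [l_m] the linear forms of [L_i], vanish on the whole
    arrangement and their wedge product is [g ^ k alpha_i] at the points of
    [X_i].  As [I_(X_i)] is prime, a field [a] is multi-logarithmic along the
    arrangement iff [<a, alpha_i>] lies in [I_(X_i)] for all [i]
    ([mlog_arrangementP]).

    As [s <= 'C(n, k)], genericity says that the common kernel of the
    [alpha_i] on constant fields has dimension ['C(n, k) - s], that is, that the
    [alpha_i] are linearly independent ([generic_dual_bases]).  Completing them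
    to a basis over the field of constants identifies the module of
    multi-logarithmic fields with the direct sum of the ideals [I_(X_i)] and of
    a free module.

    It remains to compute the projective dimension of such a sum when each
    ideal is generated by a regular sequence of length [k]
    ([sum_ideals_proj_dim]).  The truncated Koszul complexes add up to a free
    resolution of length [k - 1].  If there were a shorter projective
    resolution, comparing the two would give a retraction of the last Koszul
    differential ([last_diff_retraction]); but every linear form takes its
    values on the image of that differential in the ideal generated by the
    sequence ([kosz_minimal]), whereas the retraction yields the value [1]. *)

(** * Linear maps and projective modules *)

Definition mk_linear (S : nzRingType) (U V : lmodType S) (f : U -> V)
    (f_lin : linear f) : {linear U -> V} :=
  HB.pack f (GRing.isLinear.Build S U V _ f f_lin).

Lemma linear_sub (S : nzRingType) (U V : lmodType S) (f g : {linear U -> V}) :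
  linear (fun x => f x - g x).
Proof.
by move=> c x y; rewrite (linearP f) (linearP g) scalerBr opprD addrACA.
Qed.

Section PairInjections.
Variables (S : nzRingType) (U V : lmodType S).

Fact pair_inl_linear : linear (fun x : U => (x, 0) : (U * V)%type).
Proof. by move=> a x y; congr pair; rewrite /= scaler0 addr0. Qed.

Definition pair_inl : {linear U -> (U * V)%type} := mk_linear pair_inl_linear.

Fact pair_inr_linear : linear (fun x : V => (0, x) : (U * V)%type).
Proof. by move=> a x y; congr pair; rewrite /= scaler0 addr0. Qed.

Definition pair_inr : {linear V -> (U * V)%type} := mk_linear pair_inr_linear.

End PairInjections.
Arguments pair_inl {S} U V.
Arguments pair_inr {S} U V.

Section FiberProduct.
Variables (S : nzRingType) (A P B : lmodType S).
Variables (g : {linear A -> B}) (f : {linear P -> B}).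

Definition fiber_pred : {pred (A * P)%type} := fun z => `[< g z.1 = f z.2 >].

Fact fiber_submod_closed : submod_closed fiber_pred.
Proof.
split=> [|c u v /asboolP eu /asboolP ev]; apply/asboolP.
  by rewrite !linear0.
by rewrite /= !linearP eu ev.
Qed.

HB.instance Definition _ :=
  GRing.isSubmodClosed.Build S (A * P)%type fiber_pred fiber_submod_closed.

(** The fiber product of [g] and [f] as a module of its own; it turns lifting
    along a surjection into lifting along a map whose image is large enough. *)
Record fiber_product := FiberProduct {
  fiber_val :> (A * P)%type;
  fiber_valP : fiber_val \in fiber_pred
}.

HB.instance Definition _ := [isSub for fiber_val].
HB.instance Definition _ := [Choice of fiber_product by <:].
HB.instance Definition _ := [SubChoice_isSubLmodule of fiber_product by <:].

(** The projection of the fiber product to [P] is onto, and a section of it,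
    composed with the other projection, is a lift of [f]. *)
Lemma projective_lift : projective P ->
    (forall x, exists a, g a = f x) ->
  exists f' : {linear P -> A}, forall x, g (f' x) = f x.
Proof.
move=> projP surj.
have lin2 : linear (fun z : fiber_product => (val z).2).
  by move=> c u v; rewrite linearP.
have lin1 : linear (fun z : fiber_product => (val z).1).
  by move=> c u v; rewrite linearP.
have linid : linear (@id P) by [].
have [|h hP] := projP _ _ (mk_linear lin2) (mk_linear linid).
  move=> x; have [a ga] := surj x.
  have ax : (a, x) \in fiber_pred by apply/asboolP.
  by exists (FiberProduct ax).
exists (mk_linear lin1 \o h) => x /=.
by have /= := hP x; case: (h x) => -[a y] /asboolP /= -> ->.
Qed.

End FiberProduct.

(** * Comparison of projective resolutions *)

(** Dependent choice for a family of types: an invariant [I] that can be kept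
    along [R] from each index to the next yields a whole sequence. *)
Lemma dependent_sequence (T : nat -> Type) (I : forall i, T i -> Prop)
    (R : forall i, T i -> T i.+1 -> Prop) (x0 : T 0) :
    I 0 x0 ->
    (forall i x, I i x -> exists2 y, I i.+1 y & R i x y) ->
  exists2 t : forall i, T i, t 0 = x0 & forall i, R i (t i) (t i.+1).
Proof.
move=> I0 step.
have {}step i (z : {x | I i x}) : {y : {y | I i.+1 y} | R i (sval z) (sval y)}.
  case: z => x Ix /=; have [y Iy Ry] := cid2 (step i x Ix).
  by exists (exist _ y Iy).
pose u := fix u i : {x | I i x} :=
  match i with 0 => exist _ x0 I0 | i'.+1 => sval (step i' (u i')) end.
exists (fun i => sval (u i)) => // i.
exact: (svalP (step i (u i))).
Qed.

Section Comparison.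
Variables (S : nzRingType) (M : lmodType S).

Lemma pr_diff_aug (P : proj_resolution M) x : pr_aug P (pr_diff P 0 x) = 0.
Proof. by apply/(pr_exact0 (pr_diff P 0 x)); exists x. Qed.

Lemma pr_diff_diff (P : proj_resolution M) i x :
  pr_diff P i (pr_diff P i.+1 x) = 0.
Proof. by apply/(pr_exact (pr_diff P i.+1 x)); exists x. Qed.

Lemma comparison_maps (P Q : proj_resolution M) :
  exists2 f : forall i, {linear pr_mod P i -> pr_mod Q i},
    forall x, pr_aug Q (f 0 x) = pr_aug P x &
    forall i x, pr_diff Q i (f i.+1 x) = f i (pr_diff P i x).
Proof.
have [f0 f0P] :=
  @pr_projective _ _ P 0 _ _ (pr_aug Q) (pr_aug P) (pr_aug_surj Q).
pose inv i (f : {linear pr_mod P i -> pr_mod Q i}) := forall x,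
  exists y, pr_diff Q i y = f (pr_diff P i x).
have [||f fE fP] := @dependent_sequence
    (fun i => {linear pr_mod P i -> pr_mod Q i}) inv
    (fun i f f' => forall x, pr_diff Q i (f' x) = f (pr_diff P i x)) f0.
- by move=> x; apply/pr_exact0; rewrite f0P pr_diff_aug.
- move=> i f fi.
  have [f' f'P] := projective_lift (g := pr_diff Q i) (f := f \o pr_diff P i)
    (@pr_projective _ _ P i.+1) fi.
  exists f' => // x; apply/pr_exact.
  by rewrite f'P /= pr_diff_diff linear0.
- by exists f => // x; rewrite fE f0P.
Qed.

(** A chain map [u] over the zero map is homotopic to zero.  The homotopy
    identity is stated in positive degrees only. *)
Lemma null_homotopy (P : proj_resolution M)
    (u : forall i, {linear pr_mod P i -> pr_mod P i}) :
    (forall x, pr_aug P (u 0 x) = 0) ->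
    (forall i x, pr_diff P i (u i.+1 x) = u i (pr_diff P i x)) ->
  exists s : forall i, {linear pr_mod P i -> pr_mod P i.+1},
    forall i x, pr_diff P i.+1 (s i.+1 x) = u i.+1 x - s i (pr_diff P i x).
Proof.
move=> u0 uP.
have [|s0 s0P] := projective_lift (g := pr_diff P 0) (f := u 0)
    (@pr_projective _ _ P 0).
  by move=> x; apply/pr_exact0.
pose inv i (s : {linear pr_mod P i -> pr_mod P i.+1}) := forall x,
  exists y, pr_diff P i.+1 y = u i.+1 x - s (pr_diff P i x).
have [||s _ sP] := @dependent_sequence
    (fun i => {linear pr_mod P i -> pr_mod P i.+1}) inv
    (fun i s s' => forall x, pr_diff P i.+1 (s' x) =
       u i.+1 x - s (pr_diff P i x)) s0.
- by move=> x; apply/pr_exact; rewrite linearB /= uP s0P subrr.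
- move=> i s si.
  have lin : linear (fun x => u i.+1 x - s (pr_diff P i x)).
    exact: (linear_sub (u i.+1) (s \o pr_diff P i)).
  have [s' s'P] := projective_lift (g := pr_diff P i.+1) (f := mk_linear lin)
    (@pr_projective _ _ P i.+1) si.
  exists s' => // x; apply/pr_exact.
  by rewrite linearB /= uP s'P /= pr_diff_diff linear0 subr0 subrr.
- by exists s.
Qed.

(** The composite of comparison maps [P -> Q -> P] is zero in degree [d + 1],
    because [Q] is, and it is homotopic to the identity.  As [P] stops in
    degree [d + 1], the homotopy from degree [d] is a retraction of the last
    differential. *)
Lemma last_diff_retraction (P Q : proj_resolution M) d :
    (forall x : pr_mod P d.+2, x = 0) -> (forall x : pr_mod Q d.+1, x = 0) ->
  exists r : {linear pr_mod P d -> pr_mod P d.+1},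
    forall x, r (pr_diff P d x) = x.
Proof.
move=> P0 Q0; have [f faug fP] := comparison_maps P Q.
have [g gaug gP] := comparison_maps Q P.
have lin i : linear (fun x => x - g i (f i x)).
  exact: (linear_sub idfun (g i \o f i)).
have [||s sP] := @null_homotopy P (fun i => mk_linear (lin i)).
- by move=> x /=; rewrite linearB /= gaug faug subrr.
- by move=> i x /=; rewrite linearB /= gP fP.
exists (s d) => x; have /= := sP d x.
rewrite [f d.+1 x]Q0 linear0 subr0 [s d.+1 x]P0 linear0 => /esym/eqP.
by rewrite subr_eq0 => /eqP.
Qed.

End Comparison.

(** * Constructions of projective modules *)

Section Projective.
Variable S : nzRingType.

Lemma projective_zero (P : lmodType S) :
  (forall x : P, x = 0) -> projective P.
Proof.
move=> P0 A B g f _; have lin : linear (fun _ : P => 0 : A).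
  by move=> c x y; rewrite scaler0 addr0.
by exists (mk_linear lin) => x; rewrite [x]P0 !linear0.
Qed.

Lemma projective_ring : projective (S^o : lmodType S).
Proof.
move=> A B g f /(_ (f 1))[a ga].
have lin : linear (fun x : S^o => (x : S) *: a).
  by move=> c x y; rewrite scalerDl scalerA.
exists (mk_linear lin) => x /=.
by rewrite linearZ /= ga -linearZ /= /GRing.scale /= mulr1.
Qed.

Lemma projective_prod (P Q : lmodType S) :
  projective P -> projective Q -> projective (P * Q)%type.
Proof.
move=> pP pQ A B g f gsurj.
have [l lP] := pP _ _ g (f \o pair_inl P Q) gsurj.
have [r rP] := pQ _ _ g (f \o pair_inr P Q) gsurj.
have lin : linear (fun z : (P * Q)%type => l z.1 + r z.2).
  by move=> c x y; rewrite !linearP /= scalerDr addrACA.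
exists (mk_linear lin) => -[x y] /=.
rewrite linearD /= lP rP /= -linearD; congr (f _).
by congr pair; rewrite /= ?addr0 ?add0r.
Qed.

(** The finite function with value [x] at [i] and zero elsewhere. *)
Definition ffun_single (I : finType) (V : nmodType) (i : I) (x : V) :
    {ffun I -> V} :=
  [ffun j => if j == i then x else 0].

Lemma ffun_single_linear (I : finType) (V : lmodType S) i :
  linear (@ffun_single I V i).
Proof.
move=> c x y; apply/ffunP => j; rewrite !ffunE.
by case: eqP => //; rewrite scaler0 addr0.
Qed.

Lemma ffun_sum_single (I : finType) (V : nmodType) (w : {ffun I -> V}) :
  w = \sum_i ffun_single i (w i).
Proof.
apply/ffunP => j; rewrite sum_ffunE (bigD1 j) //= ffunE eqxx big1 ?addr0 //.
by move=> i ij; rewrite ffunE eq_sym (negbTE ij).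
Qed.

Lemma projective_ffun (I : finType) (P : lmodType S) :
  projective P -> projective {ffun I -> P}.
Proof.
move=> pP A B g f gsurj.
have lifts i :=
  cid (pP _ _ g (f \o mk_linear (@ffun_single_linear I P i)) gsurj).
have lin : linear (fun w : {ffun I -> P} => \sum_i sval (lifts i) (w i)).
  move=> c x y; rewrite scaler_sumr -big_split; apply: eq_bigr => i _.
  by rewrite !ffunE linearP.
exists (mk_linear lin) => w /=.
rewrite linear_sum [in RHS](ffun_sum_single w) linear_sum.
apply: eq_bigr => i _.
exact: (svalP (lifts i)).
Qed.

End Projective.

(** * The truncated Koszul complex *)

Section Koszul.
Variables (S : comNzRingType) (h : nat -> S).

(** Membership in the ideal generated by [h 0], ..., [h (j - 1)]. *)
Definition ideal_gen (j : nat) (f : S) : Prop :=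
  exists c : nat -> S, f = \sum_(i < j) c i * h i.

Lemma ideal_gen0 j : ideal_gen j 0.
Proof. by exists (fun=> 0); rewrite big1 // => i _; rewrite mul0r. Qed.

Lemma ideal_genD j f g : ideal_gen j f -> ideal_gen j g -> ideal_gen j (f + g).
Proof.
move=> [c ->] [d ->]; exists (fun i => c i + d i).
by rewrite -big_split; apply: eq_bigr => i _; rewrite mulrDl.
Qed.

Lemma ideal_genM j a f : ideal_gen j f -> ideal_gen j (a * f).
Proof.
move=> [c ->]; exists (fun i => a * c i).
by rewrite mulr_sumr; apply: eq_bigr => i _; rewrite mulrA.
Qed.

Lemma ideal_genS j f :
  ideal_gen j.+1 f <-> exists a g, ideal_gen j g /\ f = g + a * h j.
Proof.
split=> [[c ->]|[a [_ [[c ->] ->]]]].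
  exists (c j), (\sum_(i < j) c i * h i).
  by split; [exists c | rewrite big_ord_recr].
exists (fun i => if i == j then a else c i).
rewrite big_ord_recr /= eqxx; congr (_ + _); apply: eq_bigr => i _.
by rewrite ltn_eqF.
Qed.

(** [kosz j i] is the term of degree [i + 1] of the Koszul complex of
    [h 0, ..., h (j - 1)]: the complex is truncated and shifted so as to resolve
    the ideal rather than the quotient ring.  It is built by iterated mapping
    cones of the multiplications by the [h j]; degree [0] is special, because
    the term of degree [0] of the Koszul complex is the ring itself. *)
Fixpoint kosz (j i : nat) : lmodType S :=
  match j with
  | 0 => 'rV[S]_0
  | j'.+1 =>
    match i with
    | 0 => (kosz j' 0 * S^o)%type
    | i'.+1 => (kosz j' i'.+1 * kosz j' i')%type
    end
  end.

Lemma kosz_projective j i : projective (kosz j i).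
Proof.
elim: j i => [|j IH] i.
  by apply: projective_zero => x; apply: thinmx0.
by case: i => [|i]; apply: projective_prod => //; exact: projective_ring.
Qed.

Lemma kosz_top j i (x : kosz j i) : (j <= i)%N -> x = 0.
Proof.
elim: j i x => [|j IH] i x; first by move=> _; apply: thinmx0.
case: i x => [//|i] [a b] ji.
by rewrite (IH _ a (leqW ji)) (IH _ b ji).
Qed.

(** The augmentation, with image the ideal generated by the sequence. *)
Fixpoint kosz_aug_fun (j : nat) : kosz j 0 -> S :=
  match j return kosz j 0 -> S with
  | 0 => fun _ => 0
  | j'.+1 => fun x : (kosz j' 0 * S^o)%type =>
      kosz_aug_fun x.1 + (x.2 : S) * h j'
  end.

Fact kosz_aug_linear j : linear (@kosz_aug_fun j : kosz j 0 -> S^o).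
Proof.
elim: j => [|j IH] c x y /=; first by rewrite scaler0 addr0.
by rewrite IH mulrDl scalerDr addrACA /GRing.scale /= mulrA.
Qed.

Definition kosz_aug j : {linear kosz j 0 -> S^o} :=
  mk_linear (@kosz_aug_linear j).

(** The differential of the mapping cone: [(a, b)] goes to
    [(d a + h j b, - d b)], the augmentation taking the place of [d b] in
    degree [0]. *)
Fixpoint kosz_diff_fun (j i : nat) : kosz j i.+1 -> kosz j i :=
  match j return kosz j i.+1 -> kosz j i with
  | 0 => fun _ => 0
  | j'.+1 =>
    match i return kosz j'.+1 i.+1 -> kosz j'.+1 i with
    | 0 => fun x : (kosz j' 1 * kosz j' 0)%type =>
        (kosz_diff_fun x.1 + h j' *: x.2, - kosz_aug j' x.2)
    | i'.+1 => fun x : (kosz j' i'.+2 * kosz j' i'.+1)%type =>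
        (kosz_diff_fun x.1 + h j' *: x.2, - kosz_diff_fun x.2)
    end
  end.

Fact kosz_diff_linear j i : linear (@kosz_diff_fun j i).
Proof.
elim: j i => [|j IH] i c x y /=; first by rewrite scaler0 addr0.
have swap (V : lmodType S) (a b : V) :
    h j *: (c *: a + b) = c *: (h j *: a) + h j *: b.
  by rewrite scalerDr !scalerA mulrC.
case: i x y => [|i] x y.
  congr pair; rewrite /= ?IH ?swap ?scalerDr 1?addrACA //.
  by rewrite kosz_aug_linear opprD scalerN.
by congr pair; rewrite /= IH ?swap ?scalerDr 1?addrACA // opprD scalerN.
Qed.

Definition kosz_diff j i : {linear kosz j i.+1 -> kosz j i} :=
  mk_linear (@kosz_diff_linear j i).

Lemma kosz_augS j (a : kosz j 0) (b : S^o) :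
  kosz_aug j.+1 (a, b) = kosz_aug j a + b * h j.
Proof. by []. Qed.

Lemma kosz_augZ j a (x : kosz j 0) : kosz_aug j (a *: x) = a * kosz_aug j x.
Proof. by rewrite linearZ_LR. Qed.

Lemma kosz_diffS0 j (a : kosz j 1) (b : kosz j 0) :
  kosz_diff j.+1 0 (a, b) = (kosz_diff j 0 a + h j *: b, - kosz_aug j b).
Proof. by []. Qed.

Lemma kosz_diffSS j i (a : kosz j i.+2) (b : kosz j i.+1) :
  kosz_diff j.+1 i.+1 (a, b) =
  (kosz_diff j i.+1 a + h j *: b, - kosz_diff j i b).
Proof. by []. Qed.

Lemma kosz_augP j f : ideal_gen j f <-> exists x, kosz_aug j x = f.
Proof.
elim: j f => [|j IH] f.
  split=> [[c]|[x /= <-]]; last exact: ideal_gen0.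
  by rewrite big_ord0 => ->; exists 0.
rewrite ideal_genS; split=> [[a [g [/IH[x <-] ->]]]|[[x b] <-]].
  by exists (x, a).
exists b, (kosz_aug j x); split; last by rewrite kosz_augS.
by apply/IH; exists x.
Qed.

Lemma kosz_aug_diff j x : kosz_aug j (kosz_diff j 0 x) = 0.
Proof.
elim: j x => [|j IH] x; [by []|case: x => a b].
rewrite kosz_diffS0 kosz_augS linearD IH kosz_augZ add0r mulNr.
by rewrite mulrC subrr.
Qed.

Lemma kosz_diff_diff j i x : kosz_diff j i (kosz_diff j i.+1 x) = 0.
Proof.
elim: j i x => [|j IH] i x; [by []|case: x => a b].
rewrite kosz_diffSS; case: i a b => [|i] a b; rewrite ?kosz_diffS0 ?kosz_diffSS.
  rewrite (linearN (kosz_aug j)) kosz_aug_diff !oppr0.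
  rewrite linearD IH linearZ_LR add0r.
  by rewrite scalerN subrr.
rewrite (linearN (kosz_diff j i)) IH !oppr0 linearD IH linearZ_LR add0r.
by rewrite scalerN subrr.
Qed.

(** The sequence [h 0, ..., h (j - 1)] is regular, except that the ideal that
    it generates is not required to be proper. *)
Definition regular_upto (j : nat) : Prop := forall i, (i < j)%N ->
  forall g, ideal_gen i (g * h i) -> ideal_gen i g.

(** A cycle of the cone is a pair [(a, b)] with [b] a cycle, and then a boundary
    [b = d b']; subtracting the boundary of [(0, - b')] leaves a cycle
    [a + h j b'].  Regularity is needed in degree [0] only, where [b] is a ring
    element with [h j b] in the ideal of the preceding elements. *)
Lemma kosz_exact j : regular_upto j ->
  (forall x, kosz_aug j x = 0 -> exists y, kosz_diff j 0 y = x) /\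
  (forall i x, kosz_diff j i x = 0 -> exists y, kosz_diff j i.+1 y = x).
Proof.
elim: j => [|j IH] reg.
  by split=> [x|i x] _; exists 0; rewrite linear0 [RHS]thinmx0.
have [ex0 ex] := IH (fun i ij => reg i (ltnW ij)).
split=> [[a b]|i [a b]].
  rewrite kosz_augS => ab0.
  have /kosz_augP[b' b'P] : ideal_gen j b.
    apply: (reg j (leqnn _)); apply/kosz_augP; exists (- a).
    by rewrite linearN; apply/esym/eqP; rewrite -addr_eq0 addrC ab0.
  have [|a' a'P] := ex0 (a + h j *: b').
    by rewrite linearD kosz_augZ b'P mulrC.
  exists (a', - b'); rewrite kosz_diffS0 a'P scalerN addrK.
  by rewrite linearN opprK b'P.
case: i a b => [|i] a b.
  rewrite kosz_diffS0 => -[ab0] /eqP; rewrite oppr_eq0 => /eqP /ex0[b' b'P].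
  have [|a' a'P] := ex 0 (a + h j *: b').
    by rewrite linearD linearZ_LR b'P.
  exists (a', - b'); rewrite kosz_diffSS a'P scalerN addrK.
  by rewrite linearN opprK b'P.
rewrite kosz_diffSS => -[ab0] /eqP; rewrite oppr_eq0 => /eqP /ex[b' b'P].
have [|a' a'P] := ex i.+1 (a + h j *: b').
  by rewrite linearD linearZ_LR b'P.
exists (a', - b'); rewrite kosz_diffSS a'P scalerN addrK.
by rewrite linearN opprK b'P.
Qed.

(** The matrices of the differentials have entries in the ideal. *)
Lemma kosz_minimal j i (phi : {linear kosz j i -> S^o}) x :
  ideal_gen j (phi (kosz_diff j i x)).
Proof.
elim: j i phi x => [|j IH] i phi x.
  by rewrite [kosz_diff _ _ _]thinmx0 linear0; exact: ideal_gen0.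
have incl f : ideal_gen j f -> ideal_gen j.+1 f.
  by move=> fj; apply/ideal_genS; exists 0, f; rewrite mul0r addr0.
have hj a : ideal_gen j.+1 (h j * a).
  apply/ideal_genS; exists a, 0; rewrite add0r mulrC.
  by split=> //; exact: ideal_gen0.
case: i phi x => [|i] phi [a b]; rewrite ?kosz_diffS0 ?kosz_diffSS.
  have -> : (kosz_diff j 0 a + h j *: b, - kosz_aug j b) =
      ((kosz_diff j 0 a, 0) + h j *: (b, 0)) + (- kosz_aug j b) *: (0, 1)
      :> (kosz j 0 * S^o)%type.
    congr pair; rewrite /= ?scaler0 ?addr0 ?add0r //.
    by rewrite /GRing.scale /= mulr1.
  rewrite linearD linearD !linearZ_LR; apply: ideal_genD.
    by apply: ideal_genD; [apply/incl/(IH 0 (phi \o pair_inl _ _)) | exact: hj].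
  rewrite /GRing.scale /= mulNr -mulrN mulrC; apply: ideal_genM.
  by apply/incl/kosz_augP; exists b.
have -> : (kosz_diff j i.+1 a + h j *: b, - kosz_diff j i b) =
    ((kosz_diff j i.+1 a, 0) + h j *: (b, 0)) + (-1) *: (0, kosz_diff j i b)
    :> (kosz j i.+1 * kosz j i)%type.
  by congr pair; rewrite /= ?scaler0 ?addr0 ?add0r // scaleN1r.
rewrite linearD linearD !linearZ_LR; apply: ideal_genD.
  apply: ideal_genD; last exact: hj.
  exact/incl/(IH i.+1 (phi \o pair_inl _ _)).
by apply: ideal_genM; apply/incl/(IH i (phi \o pair_inr _ _)).
Qed.

(** The last nonzero term is free of rank one; only a generator and its
    coordinate are needed. *)
Lemma kosz_top_generator j :
  exists (phi : {linear kosz j.+1 j -> S^o}) (x : kosz j.+1 j), phi x = 1.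
Proof.
elim: j => [|j [phi [x phix]]].
  have lin : linear (fun z : kosz 1 0 => z.2 : S^o) by [].
  by exists (mk_linear lin), (0, 1).
have lin : linear (fun z : kosz j.+2 j.+1 => phi z.2).
  by move=> c [a b] [a' b']; rewrite -linearP.
by exists (mk_linear lin), (0, x).
Qed.

End Koszul.

(** * Completing independent linear forms to a basis *)

(** The columns of [A] are linear forms and the rows of [B] a basis of their
    common kernel.  As it has dimension [N - s], the forms are independent, and
    they can be completed: [(A | Q)] and the matrix with blocks [D] over [B] are
    inverse to each other. *)
Lemma dual_bases_mx (F : fieldType) (N s c : nat)
    (A : 'M[F]_(N, s)) (B : 'M[F]_(c, N)) :
    (s + c = N)%N -> row_free B -> (kermx A <= B)%MS -> B *m A = 0 ->
  exists (D : 'M[F]_(s, N)) (Q : 'M[F]_(N, c)),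
    [/\ D *m A = 1%:M, A *m D + Q *m B = 1%:M, B *m Q = 1%:M & D *m Q = 0].
Proof.
move=> scN Bfree kerB BA.
have rkA : row_full A.
  have eqK : (kermx A == B)%MS by rewrite kerB sub_kermx BA eqxx.
  have rkK : \rank B = (N - \rank A)%N by rewrite -mxrank_ker (eqmxP eqK).
  have rkN := rank_leq_row A; rewrite /row_full.
  by rewrite -(eqn_add2r c) scN -[X in (_ + X)%N](eqP Bfree) rkK subnKC.
have [D DA] := row_fullP rkA; exists D.
have /submxP[Q QE] : (1%:M - A *m D <= B)%MS.
  apply: submx_trans kerB; rewrite sub_kermx mulmxBl mul1mx.
  by rewrite -mulmxA DA mulmx1 subrr.
exists Q; split=> //.
- by rewrite -QE addrC subrK.
- apply: (row_free_inj Bfree); rewrite -mulmxA -QE mulmxBr mulmxA BA mul0mx.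
  by rewrite mulmx1 subr0 mul1mx.
- apply: (row_free_inj Bfree); rewrite -mulmxA -QE mulmxBr mulmxA DA mulmx1.
  by rewrite mul1mx subrr mul0mx.
Qed.

(** The same with coordinates indexed by a finite type [T]. *)
Lemma dual_bases (F : fieldType) (T : finType) (s c : nat)
    (al : 'I_s -> T -> F) (b : 'I_c -> T -> F) :
    (s + c = #|T|)%N ->
    (forall q : 'I_c -> F,
       (forall t, \sum_j q j * b j t = 0) -> forall j, q j = 0) ->
    (forall v : T -> F, (forall i, \sum_t v t * al i t = 0) ->
       exists q : 'I_c -> F, forall t, v t = \sum_j q j * b j t) ->
    (forall j i, \sum_t b j t * al i t = 0) ->
  exists (D : 'I_s -> T -> F) (Q : T -> 'I_c -> F),
    [/\ forall i i', \sum_t D i t * al i' t = (i == i')%:R,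
        forall t t', \sum_i al i t * D i t' + \sum_j Q t j * b j t' =
                     (t == t')%:R,
        forall j j', \sum_t b j t * Q t j' = (j == j')%:R
      & forall i j, \sum_t D i t * Q t j = 0].
Proof.
move=> scT bfree bker bal.
have sumT (f : T -> F) : \sum_t f t = \sum_(i < #|T|) f (enum_val i).
  by rewrite (reindex (@enum_val T predT)) //; apply/onW_bij/enum_val_bij.
pose A := \matrix_(t < #|T|, i < s) al i (enum_val t).
pose B := \matrix_(j < c, t < #|T|) b j (enum_val t).
have Bfree : row_free B.
  apply: inj_row_free => v vB; apply/rowP => j; rewrite mxE.
  apply: (bfree (v 0)) => t; have /rowP/(_ (enum_rank t)) := vB.
  rewrite !mxE => e0; rewrite -[RHS]e0; apply: eq_bigr => i _.
  by rewrite mxE enum_rankK.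
have [||D [Q [DA ADQB BQ DQ]]] := @dual_bases_mx F #|T| s c A B scT Bfree.
- apply/row_subP => r; apply/submxP.
  have [|q qE] := bker (fun t => kermx A r (enum_rank t)).
    move=> i; rewrite sumT; have /matrixP/(_ r i) := mulmx_ker A.
    rewrite !mxE => e0; rewrite -[RHS]e0; apply: eq_bigr => t _.
    by rewrite [A _ _]mxE enum_valK.
  exists (\row_j q j); apply/rowP => t; rewrite [LHS]mxE [RHS]mxE.
  have := qE (enum_val t); rewrite enum_valK => ->.
  by apply: eq_bigr => j _; rewrite [B _ _]mxE [in RHS]mxE.
- apply/matrixP => j i; rewrite !mxE -[RHS](bal j i) sumT.
  by apply: eq_bigr => t _; rewrite !mxE.
exists (fun i t => D i (enum_rank t)), (fun t j => Q (enum_rank t) j); split.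
- move=> i i'; rewrite sumT; have /matrixP/(_ i i') := DA.
  by rewrite !mxE => <-; apply: eq_bigr => t _; rewrite ?mxE enum_valK.
- move=> t t'; have /matrixP/(_ (enum_rank t) (enum_rank t')) := ADQB.
  rewrite !mxE (inj_eq enum_rank_inj) => <-.
  by congr (_ + _); apply: eq_bigr => j _; rewrite ?mxE enum_rankK.
- move=> j j'; rewrite sumT; have /matrixP/(_ j j') := BQ.
  by rewrite !mxE => <-; apply: eq_bigr => t _; rewrite ?mxE enum_valK.
- move=> i j; rewrite sumT; have /matrixP/(_ i j) := DQ.
  rewrite !mxE => e0; rewrite -[RHS]e0; apply: eq_bigr => t _.
  by rewrite ?mxE enum_valK.
Qed.

(** * Polynomials vanishing on a subspace *)

Lemma mpoly_alg_ind (R : comNzRingType) (n : nat) (P : {mpoly R[n]} -> Prop) :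
    (forall c, P c%:MP) -> (forall i, P 'X_i) ->
    (forall p q, P p -> P q -> P (p + q)) ->
    (forall p q, P p -> P q -> P (p * q)) ->
  forall p, P p.
Proof.
move=> PC PX PD PM; elim/mpolyind => [|c m p _ _ Pp]; first by rewrite -mpolyC0.
apply: PD Pp; rewrite -mul_mpolyC; apply: (PM) => //.
rewrite mpolyXE_id; apply: (big_ind P) => [||i _].
- by rewrite -mpolyC1.
- exact: PM.
- by elim: (m i) => [|e IH]; rewrite ?expr0 -?mpolyC1 // exprS; apply: (PM).
Qed.

Lemma mderivXU (R : comNzRingType) (n : nat) (i j : 'I_n) :
  ('X_i : {mpoly R[n]})^`M(j) = (i == j)%:R.
Proof.
rewrite mderivX mnm1E; case: eqVneq => [->|_]; last by rewrite scale0r.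
rewrite scale1r -mpolyX0; congr 'X_[_]; apply/mnmP => r.
by rewrite mnmBE subnn mnm0E.
Qed.

Lemma poly_vanish_eq0 (F : numDomainType) (p : {poly F}) :
  (forall t, p.[t] = 0) -> p = 0.
Proof.
move=> p0; apply/eqP/negPn/negP => /max_poly_roots.
move=> /(_ [seq i%:R | i <- iota 0 (size p)]).
rewrite size_map size_iota ltnn => H; suff: false by []; apply: H.
  by apply/allP => t _; rewrite /root p0.
rewrite map_inj_uniq ?iota_uniq // => i j /eqP.
by rewrite Num.Theory.eqr_nat => /eqP.
Qed.

Section Line.
Variables (F : fieldType) (n : nat) (x v : 'rV[F]_n).

(** The restriction of [f] to the line [x + t v], as a polynomial in [t]. *)
Definition line_poly (f : {mpoly F[n]}) : {poly F} :=
  mmap (@polyC F) (fun i => (x 0 i)%:P + (v 0 i)%:P * 'X) f.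

Lemma horner_line_poly f t :
  (line_poly f).[t] = f.@[fun i => (x + t *: v) 0 i].
Proof.
rewrite /line_poly; elim/mpoly_alg_ind: f => [c|i|p q hp hq|p q hp hq].
- by rewrite mmapC mevalC hornerC.
- by rewrite mmapX mmap1U mevalXU !mxE !hornerE mulrC.
- by rewrite mmapD mevalD hornerD hp hq.
- by rewrite rmorphM mevalM hornerM hp hq.
Qed.

Lemma deriv_line_poly f :
  (line_poly f)^`() = \sum_i (v 0 i)%:P * line_poly f^`M(i).
Proof.
rewrite /line_poly; elim/mpoly_alg_ind: f => [c|i|p q hp hq|p q hp hq].
- by rewrite mmapC derivC big1 // => i _; rewrite mderivC mmap0 mulr0.
- rewrite mmapX mmap1U derivD derivM !derivC derivX mul0r mulr1 !add0r.
  rewrite (bigD1 i) //= mderivXU eqxx rmorph1 mulr1 big1 ?addr0 // => j ji.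
  by rewrite mderivXU eq_sym (negbTE ji) rmorph0 mulr0.
- rewrite mmapD derivD hp hq -big_split; apply: eq_bigr => i _ /=.
  by rewrite mderivD mmapD mulrDr.
- rewrite rmorphM derivM hp hq mulr_suml mulr_sumr -big_split.
  apply: eq_bigr => i _ /=; rewrite mderivM mmapD !rmorphM mulrDr.
  by congr (_ + _); [rewrite mulrA | rewrite mulrCA].
Qed.

End Line.

Section VanishOnSubspace.
Variables (F : numFieldType) (n : nat) (U : {vspace 'rV[F]_n}).

(** The differential of [f] at a point of [U] vanishes on [U]: restrict [f] to
    a line of [U]. *)
Lemma vanishing_deriv (f : {mpoly F[n]}) (x v : 'rV[F]_n) :
    vanishing_ideal (vspace_set U) f -> x \in U -> v \in U ->
  \sum_i v 0 i * f^`M(i).@[fun j => x 0 j] = 0.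
Proof.
move=> fU xU vU; have : line_poly x v f = 0.
  apply: poly_vanish_eq0 => t; rewrite horner_line_poly; apply: fU.
  by rewrite /vspace_set rpredD ?rpredZ.
move/(congr1 (fun p => p^`().[0])); rewrite deriv_line_poly linear0 horner0.
rewrite horner_sum => e0; rewrite -[RHS]e0; apply: eq_bigr => i _.
rewrite hornerM hornerC horner_line_poly; congr (_ * _).
by apply: meval_eq => j; rewrite scale0r addr0.
Qed.

(** The vanishing ideal of a subspace is prime: on the line through a point
    where [p] is nonzero and any other point, one of the two restrictions is
    zero. *)
Lemma vanishing_prime (p q : {mpoly F[n]}) :
    vanishing_ideal (vspace_set U) (p * q) ->
    ~ vanishing_ideal (vspace_set U) p ->
  vanishing_ideal (vspace_set U) q.
Proof.
move=> pqU /existsNP[x /not_implyP[xU px]] y yU.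
have /eqP : line_poly x (y - x) p * line_poly x (y - x) q = 0.
  apply: poly_vanish_eq0 => t; rewrite hornerM !horner_line_poly -mevalM.
  by apply: pqU; rewrite /vspace_set rpredD ?rpredZ ?rpredB.
rewrite mulf_eq0 => /orP[] /eqP l0.
  case: px; rewrite -[RHS](horner0 0) -l0 horner_line_poly.
  by apply: meval_eq => j; rewrite scale0r addr0.
rewrite -[RHS](horner0 1) -l0 horner_line_poly.
by apply: meval_eq => j; rewrite scale1r addrC subrK.
Qed.

(** The rows of [L] define [U], and they span the linear forms that vanish
    on [U]. *)
Lemma subspace_equations k : (\dim U + k)%N = n ->
  exists L : 'M[F]_(k, n),
    (forall x, (x \in U) = (L *m x^T == 0)) /\
    (forall w : 'rV_n, (forall v, v \in U -> w *m v^T = 0) -> (w <= L)%MS).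
Proof.
move=> dimU.
pose B := \matrix_(i < \dim U) (vbasis U)`_i.
have Bcomb (y : 'rV_(\dim U)) : y *m B = \sum_i y 0 i *: (vbasis U)`_i.
  by rewrite mulmx_sum_row; apply: eq_bigr => i _; rewrite rowK.
have Bfree : row_free B.
  apply: inj_row_free => y; rewrite Bcomb => yB; apply/rowP => i; rewrite mxE.
  by move/freeP: (basis_free (vbasisP U)) => /(_ (y 0) yB i).
have BU x : (x \in U) = (x <= B)%MS.
  apply/idP/submxP => [xU|[y ->]].
    exists (\row_i coord (vbasis U) i x); rewrite Bcomb {1}(coord_vbasis xU).
    by apply: eq_bigr => i _; rewrite mxE.
  rewrite Bcomb; apply: memv_suml => i _; apply: memvZ.
  by apply: vbasis_mem; rewrite mem_nth // size_tuple.
have [L LK] : exists L : 'M[F]_(k, n), (L :=: kermx B^T)%MS.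
  have rk : \rank (kermx B^T) = k.
    by rewrite mxrank_ker mxrank_tr (eqP Bfree) -[RHS](addKn (\dim U)) dimU.
  move: (row_base (kermx B^T)) (eq_row_base (kermx B^T)).
  by rewrite rk => L; exists L.
have LB : L *m B^T = 0 by apply/eqP; rewrite -sub_kermx LK.
exists L; split=> [x|w wU]; last first.
  rewrite LK sub_kermx; apply/eqP/trmx_inj; rewrite trmx_mul trmxK trmx0.
  apply/row_matrixP => i; rewrite row_mul row0 rowK.
  rewrite -[LHS]trmxK trmx_mul trmxK wU ?trmx0 //.
  by rewrite vbasis_mem ?mem_nth ?size_tuple.
rewrite BU; apply/idP/eqP => [/submxP[y ->]|Lx].
  by rewrite trmx_mul mulmxA LB mul0mx.
rewrite submxE.
have /submxP[Y YE] : ((cokermx B)^T <= L)%MS.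
  by rewrite LK sub_kermx -trmx_mul mulmx_coker trmx0.
by rewrite -[cokermx B]trmxK YE -[x]trmxK -trmx_mul -mulmxA Lx mulmx0 trmx0.
Qed.

End VanishOnSubspace.

Section LinearForms.
Variables (F : fieldType) (n k : nat) (L : 'M[F]_(k, n)).

(** The linear form with coefficients the [i]-th row of [L]. *)
Definition linear_form (i : 'I_k) : {mpoly F[n]} :=
  \sum_j (L i j)%:MP * 'X_j.

Lemma meval_linear_form i (x : 'rV[F]_n) :
  (linear_form i).@[fun j => x 0 j] = (L *m x^T) i 0.
Proof.
rewrite raddf_sum mxE; apply: eq_bigr => j _ /=.
by rewrite mevalM mevalC mevalXU mxE.
Qed.

Lemma mderiv_linear_form i j : (linear_form i)^`M(j) = (L i j)%:MP.
Proof.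
rewrite raddf_sum (bigD1 j) //= mderiv_mulC mderivXU eqxx mulr1.
rewrite big1 ?addr0 // => r rj.
by rewrite mderiv_mulC mderivXU (negbTE rj) mulr0.
Qed.

End LinearForms.

(** * Multi-logarithmic fields along a subspace *)

Section Plucker.
Variables (F : numFieldType) (n k : nat).

(** The coordinate on [dx_E] of the wedge product of the rows of [G]. *)
Definition plucker (G : 'M[F]_(k, n)) (E : ksubset n k) : F :=
  \det (\matrix_(i < k, j < k) G i (ksubset_nth E j)).

Lemma plucker_mul (C : 'M[F]_k) (L : 'M[F]_(k, n)) E :
  plucker (C *m L) E = \det C * plucker L E.
Proof.
rewrite /plucker -det_mulmx; congr (\det _); apply/matrixP => i j.
by rewrite !mxE; apply: eq_bigr => l _; rewrite mxE.
Qed.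

(** The pairing of [a] with the wedge product of the rows of [L], a form with
    constant coefficients. *)
Definition plucker_form (L : 'M[F]_(k, n)) (a : kvector_field F n k) :
    {mpoly F[n]} :=
  \sum_E (plucker L E)%:MP * (a E : {mpoly F[n]}).

Lemma meval_plucker_form L a x :
  (plucker_form L a).@[x] = \sum_E plucker L E * (a E : {mpoly F[n]}).@[x].
Proof.
rewrite /plucker_form raddf_sum; apply: eq_bigr => E _ /=.
by rewrite mevalM mevalC.
Qed.

(** The rows are the differentials of the [f i] at the point [x]. *)
Definition jacobian_at (f : 'I_k -> {mpoly F[n]}) (x : 'rV[F]_n) :
    'M[F]_(k, n) :=
  \matrix_(i, l) (f i)^`M(l).@[fun j => x 0 j].

Lemma meval_pairing (a : kvector_field F n k) f (x : 'rV[F]_n) :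
  (pairing a (wedge (fun i => ext_d (f i)))).@[fun j => x 0 j] =
  \sum_E plucker (jacobian_at f x) E * (a E : {mpoly F[n]}).@[fun j => x 0 j].
Proof.
rewrite /pairing raddf_sum; apply: eq_bigr => E _ /=.
rewrite mevalM mulrC ffunE; congr (_ * _).
rewrite -det_map_mx; congr (\det _); apply/matrixP => i j.
by rewrite !mxE.
Qed.

Variables (U : {vspace 'rV[F]_n}) (L : 'M[F]_(k, n)).

(** At a point of [U] the differentials of the [f i] are combinations of the
    rows of [L], so their wedge product is a multiple of that of the rows. *)
Lemma pairing_vanish (a : kvector_field F n k) (f : 'I_k -> {mpoly F[n]}) :
    (forall w : 'rV_n, (forall v, v \in U -> w *m v^T = 0) -> (w <= L)%MS) ->
    vanishing_ideal (vspace_set U) (plucker_form L a) ->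
    (forall i, vanishing_ideal (vspace_set U) (f i)) ->
  vanishing_ideal (vspace_set U) (pairing a (wedge (fun i => ext_d (f i)))).
Proof.
move=> annU La fU x xU.
have /submxP[C GC] : (jacobian_at f x <= L)%MS.
  apply/row_subP => i; apply: annU => v vU; apply/matrixP => r c.
  rewrite !mxE -[RHS](vanishing_deriv (fU i) xU vU); apply: eq_bigr => l _.
  by rewrite !mxE ord1 mulrC.
rewrite meval_pairing GC; apply: etrans (mulr0 (\det C)).
rewrite -[X in _ = _ * X](La x xU) meval_plucker_form mulr_sumr.
apply: eq_bigr => E _.
by rewrite plucker_mul mulrA.
Qed.

(** Here [Y] contains [U] and [g] vanishes on the part of [Y] outside [U]; the
    products of [g] with the linear forms of [L] vanish on [Y]. *)
Lemma plucker_form_vanish (a : kvector_field F n k) (Y : set 'rV[F]_n)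
    (g : {mpoly F[n]}) :
    (forall x, x \in U -> L *m x^T = 0) ->
    (forall x, vspace_set U x -> Y x) ->
    (forall x, Y x -> x \in U \/ g.@[fun j => x 0 j] = 0) ->
    ~ vanishing_ideal (vspace_set U) g ->
    is_mlog Y a ->
  vanishing_ideal (vspace_set U) (plucker_form L a).
Proof.
move=> LU UY Yg gU aY.
have lU i x : x \in U -> (linear_form L i).@[fun j => x 0 j] = 0.
  by move=> /LU Lx; rewrite meval_linear_form Lx mxE.
have flY i : vanishing_ideal Y (g * linear_form L i).
  by move=> x /Yg[/lU lx|gx]; rewrite mevalM ?lx ?gx ?mulr0 ?mul0r.
have gkU : ~ vanishing_ideal (vspace_set U) (g ^+ k).
  move=> gk; apply: gU => x xU; apply/eqP.
  have /eqP := gk x xU; rewrite rmorphXn /= expf_eq0 => /andP[_].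
  by [].
apply: vanishing_prime gkU => x xU.
rewrite mevalM rmorphXn /= -(det_scalar k) meval_plucker_form mulr_sumr.
apply: etrans (aY _ flY x (UY x xU)); rewrite meval_pairing.
apply: eq_bigr => E _.
rewrite mulrA -plucker_mul; congr (plucker _ E * _); apply/matrixP => i j.
rewrite mul_scalar_mx !mxE mderivM mevalD !mevalM lU // mulr0 add0r.
by rewrite mderiv_linear_form mevalC.
Qed.

End Plucker.

(** * A direct sum of ideals generated by regular sequences *)

Section SumOfIdeals.
Variables (S : comNzRingType) (M : lmodType S) (s c k : nat).
Variable h : 'I_s -> nat -> S.
(** Through [phi], the module [M] is the direct sum of the ideals generated by
    the first [k] terms of the sequences [h i] and of a free module of
    rank [c]. *)
Variable phi : {linear M -> ({ffun 'I_s -> S^o} * {ffun 'I_c -> S^o})%type}.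
Hypothesis phi_inj : forall m, phi m = 0 -> m = 0.
Hypothesis phi_image : forall w,
  (exists m, phi m = w) <-> forall i, ideal_gen (h i) k (w.1 i).
Hypothesis h_regular : forall i, regular_upto (h i) k.

(** The Koszul modules do not depend on the sequence, so that a direct sum over
    ['I_s] is a module of finite functions.  The free summand of [M] is its own
    resolution, in degree [0]. *)
Definition res_mod (i : nat) : lmodType S :=
  ({ffun 'I_s -> kosz S k i} * {ffun 'I_(if i is 0 then c else 0) -> S^o})%type.

(** The Koszul differentials of the [h l], and zero on the free summand. *)
Definition res_diff_fun i (x : res_mod i.+1) : res_mod i :=
  ([ffun l => kosz_diff (h l) k i (x.1 l)], 0).

Fact res_diff_linear i : linear (@res_diff_fun i).
Proof.
move=> a x y; congr pair; last by rewrite /= scaler0 addr0.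
by apply/ffunP => l; rewrite !ffunE linearP.
Qed.

Definition res_diff i : {linear res_mod i.+1 -> res_mod i} :=
  mk_linear (@res_diff_linear i).

Lemma res_projective i : projective (res_mod i).
Proof.
apply: projective_prod; apply: projective_ffun; last exact: projective_ring.
exact: kosz_projective.
Qed.

Lemma res_top i (x : res_mod i.+1) : (k <= i.+1)%N -> x = 0.
Proof.
case: x => w z ki; congr pair; apply/ffunP => l; last by case: l.
by rewrite ffunE; apply: kosz_top.
Qed.

(** The augmentation followed by [phi]; it lifts to [M] since its source is
    projective and it takes its values in the image of [phi]. *)
Definition res_aug_val (x : res_mod 0) :
    ({ffun 'I_s -> S^o} * {ffun 'I_c -> S^o})%type :=
  ([ffun l => kosz_aug (h l) k (x.1 l)], x.2).

Fact res_aug_val_linear : linear res_aug_val.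
Proof.
by move=> a x y; congr pair; apply/ffunP => l; rewrite !ffunE linearP.
Qed.

Lemma res_aug_exists :
  exists f : {linear res_mod 0 -> M}, forall x, phi (f x) = res_aug_val x.
Proof.
apply: (projective_lift (f := mk_linear res_aug_val_linear)).
  exact: res_projective.
move=> x; apply/phi_image => i; rewrite /= ffunE.
by apply/kosz_augP; exists (x.1 i).
Qed.

Definition res_aug := sval (cid res_aug_exists).

Lemma phi_res_aug x : phi (res_aug x) = res_aug_val x.
Proof. exact: (svalP (cid res_aug_exists)). Qed.

Lemma res_aug_surj m : exists x, res_aug x = m.
Proof.
have /phi_image mi : exists m', phi m' = phi m by exists m.
have [u uP] := choice (fun i => (kosz_augP (h i) k ((phi m).1 i)).1 (mi i)).
exists ([ffun i => u i], (phi m).2).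
apply/eqP; rewrite -subr_eq0; apply/eqP/phi_inj; rewrite linearB phi_res_aug.
apply/eqP; rewrite subr_eq0; apply/eqP; rewrite [RHS]surjective_pairing.
congr pair; apply/ffunP => i.
by rewrite !ffunE uP.
Qed.

Lemma ffun_exact (I : finType) (A B C : nmodType) (f : I -> A -> B)
    (g : I -> B -> C) (y : {ffun I -> B}) :
    (forall i b, g i b = 0 <-> exists a, f i a = b) ->
  [ffun i => g i (y i)] = 0 <->
  exists x : {ffun I -> A}, [ffun i => f i (x i)] = y.
Proof.
move=> ex; split=> [/ffunP y0|[x <-]]; last first.
  by apply/ffunP => i; rewrite !ffunE; apply/ex; exists (x i).
have /choice[x xP] i : exists a, f i a = y i.
  by apply/ex; have := y0 i; rewrite !ffunE.
by exists [ffun i => x i]; apply/ffunP => i; rewrite !ffunE.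
Qed.

Lemma res_exact0 x : res_aug x = 0 <-> exists y, res_diff 0 y = x.
Proof.
have ex l b : kosz_aug (h l) k b = 0 <-> exists a, kosz_diff (h l) k 0 a = b.
  split; first exact: (kosz_exact (@h_regular l)).1.
  by case=> a <-; exact: kosz_aug_diff.
have <- : res_aug_val x = 0 <-> res_aug x = 0.
  rewrite -phi_res_aug; split=> [/phi_inj //|->]; exact: linear0.
case: x => w v; split=> [[w0 v0]|[[y z] [<- <-]]].
  have [y yw] := (ffun_exact w ex).1 w0.
  by exists (y, 0); congr pair; rewrite ?v0.
congr pair; apply/(ffun_exact _ ex); by exists y.
Qed.

Lemma res_exact i x : res_diff i x = 0 <-> exists y, res_diff i.+1 y = x.
Proof.
have ex l b : kosz_diff (h l) k i b = 0 <->
    exists a, kosz_diff (h l) k i.+1 a = b.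
  split; first exact: (kosz_exact (@h_regular l)).2.
  by case=> a <-; exact: kosz_diff_diff.
case: x => w v; split=> [[w0]|[[y z] [<- _]]].
  have [y yw] := (ffun_exact w ex).1 w0.
  by exists (y, 0); congr pair => //; apply/ffunP => -[].
congr pair; apply/(ffun_exact _ ex); by exists y.
Qed.

Definition sum_ideals_resolution : proj_resolution M :=
  ProjResolution res_projective res_aug_surj res_exact0 res_exact.

Hypothesis k_gt0 : (0 < k)%N.
Variable i0 : 'I_s.
Hypothesis h_proper : ~ ideal_gen (h i0) k 1.

(** The element of [M] with [h i0 0] as its only coordinate is nonzero: were
    [h i0 0] zero, regularity would put [1] in the zero ideal. *)
Lemma sum_ideals_neq0 : exists m : M, m != 0.
Proof.
have [m mP] : exists m, phi m = (ffun_single i0 (h i0 0 : S^o), 0).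
  apply/phi_image => i; rewrite /= ffunE.
  case: eqP => [->|_]; last exact: ideal_gen0.
  rewrite -(prednK k_gt0); exists (fun l => (l == 0)%:R).
  by rewrite big_ord_recl mul1r big1 ?addr0 // => l _; rewrite mul0r.
exists m; apply/eqP => m0; apply: h_proper.
have h0 : h i0 0 = 0.
  move: mP; rewrite m0 linear0 => -[/ffunP/(_ i0)]; rewrite !ffunE eqxx.
  by move=> <-.
have [cf ->] : ideal_gen (h i0) 0 1.
  by apply: (h_regular k_gt0); rewrite h0 mulr0; exact: ideal_gen0.
by rewrite big_ord0; exact: ideal_gen0.
Qed.

(** Applied to the last Koszul generator of the summand [i0], a retraction of
    the last differential would put [1] in the ideal of [h i0]. *)
Lemma sum_ideals_pd_ge e : (e < k.-1)%N -> ~ has_proj_resolution M e.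
Proof.
move=> ek [Q Q0]; have [d kE] : exists d, k = d.+2.
  by case: k ek => [|[|d]] //; exists d.
have [||r rP] := @last_diff_retraction _ _ sum_ideals_resolution Q d.
- by move=> x; apply: res_top; rewrite kE.
- by apply: Q0; rewrite kE in ek.
have [psi [t psit]] : exists (psi : {linear kosz S k d.+1 -> S^o}) t, psi t = 1.
  by rewrite kE; exact: kosz_top_generator.
pose emb : {linear kosz S k d -> res_mod d} :=
  pair_inl _ _ \o mk_linear (@ffun_single_linear S 'I_s _ i0).
have lin : linear (fun x => psi ((r (emb x) : res_mod d.+1).1 i0)).
  by move=> a x y; rewrite (linearP emb) (linearP r) /= !ffunE linearP.
pose u : res_mod d.+1 := (ffun_single i0 t, 0).
have uE : res_diff d u = emb (kosz_diff (h i0) k d t).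
  congr pair; apply/ffunP => l; rewrite !ffunE.
  by case: eqP => [->|_] //; rewrite linear0.
have mini : ideal_gen (h i0) k
    (psi ((r (emb (kosz_diff (h i0) k d t)) : res_mod d.+1).1 i0)).
  exact: (kosz_minimal (h i0) (mk_linear lin) t).
apply: h_proper; move: mini; rewrite -uE.
by rewrite (rP u) /= ffunE eqxx psit.
Qed.

Lemma sum_ideals_proj_dim : proj_dim_eq M k.-1.
Proof.
split; [exact: sum_ideals_neq0 | | exact: sum_ideals_pd_ge].
exists sum_ideals_resolution => -[//|i] ki x; apply: res_top.
by rewrite -ltnS -(prednK k_gt0) ltnS in ki *.
Qed.

End SumOfIdeals.

(** * Multi-logarithmic fields along an arrangement *)

Section Arrangement.
Variables (F : numFieldType) (n k : nat).

Lemma separating_poly (U V : {vspace 'rV[F]_n}) :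
    ~~ (U <= V)%VS -> (\dim V + k)%N = n ->
  exists p : {mpoly F[n]}, vanishing_ideal (vspace_set V) p /\
                           ~ vanishing_ideal (vspace_set U) p.
Proof.
move=> /subvPn[y yU yV] /subspace_equations[L [LV _]].
have [i Liy] : exists i, (L *m y^T) i 0 != 0.
  apply/existsP; apply: contraR yV; rewrite negb_exists LV => /forallP Ly.
  apply/eqP/matrixP => i j; rewrite ord1 [RHS]mxE.
  by apply/eqP; rewrite -[_ == _]negbK Ly.
exists (linear_form L i); split=> [x xV|/(_ y yU)].
  by move: xV; rewrite /vspace_set LV meval_linear_form => /eqP ->; rewrite mxE.
by rewrite meval_linear_form => /eqP; apply/negP.
Qed.

Lemma vanishing_prod (U : {vspace 'rV[F]_n}) (I : finType) (P : pred I)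
    (p : I -> {mpoly F[n]}) :
    (forall i, P i -> ~ vanishing_ideal (vspace_set U) (p i)) ->
  ~ vanishing_ideal (vspace_set U) (\prod_(i | P i) p i).
Proof.
move=> pU; apply: (big_ind (fun q => ~ vanishing_ideal (vspace_set U) q)) => //.
  by move=> /(_ 0 (mem0v U)); rewrite meval1 => /eqP; rewrite oner_eq0.
by move=> q r qU rU qrU; apply/rU/(vanishing_prime qrU).
Qed.

Variables (s : nat) (X : 'I_s -> {vspace 'rV[F]_n}).
Variable L : 'I_s -> 'M[F]_(k, n).
Hypothesis X_arr : subspace_arrangement k X.
Hypothesis LX : forall i x, (x \in X i) = (L i *m x^T == 0).
Hypothesis annX : forall i (w : 'rV_n),
  (forall v, v \in X i -> w *m v^T = 0) -> (w <= L i)%MS.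

Lemma mlog_subspaceP i (a : kvector_field F n k) :
  is_mlog (vspace_set (X i)) a <->
  vanishing_ideal (vspace_set (X i)) (plucker_form (L i) a).
Proof.
split=> [aX|La f fX].
  apply: (plucker_form_vanish (Y := vspace_set (X i)) (g := 1)) => //.
  - by move=> x; rewrite LX => /eqP.
  - by move=> x; left.
  - by move=> /(_ 0 (mem0v _)); rewrite meval1 => /eqP; rewrite oner_eq0.
exact: pairing_vanish (@annX i) La fX.
Qed.

Lemma mlog_arrangementP (a : kvector_field F n k) :
  is_mlog (arrangement_set X) a <->
  forall i, vanishing_ideal (vspace_set (X i)) (plucker_form (L i) a).
Proof.
case: X_arr => X_inj X_dim.
split=> [aX i|La f fX x [i xi]]; last first.
  apply: (pairing_vanish (@annX i) (La i)) xi => j y yi.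
  by apply: fX; exists i.
have sep j : exists p : {mpoly F[n]}, j != i ->
    vanishing_ideal (vspace_set (X j)) p /\
    ~ vanishing_ideal (vspace_set (X i)) p.
  have [->|ji] := eqVneq j i; first by exists 0.
  have [|p pP] := separating_poly (U := X i) _ (X_dim j); last by exists p.
  (* Distinct subspaces of the same dimension do not contain one another. *)
  apply: contra ji => Xij; apply/eqP/X_inj/eqP; rewrite eq_sym eqEdim Xij /=.
  by rewrite -(leq_add2r k) !X_dim.
have [p pP] := choice sep.
apply: (plucker_form_vanish (Y := arrangement_set X)
         (g := \prod_(j | j != i) p j)) => //.
- by move=> x; rewrite LX => /eqP.
- by move=> x xi; exists i.
- move=> x [j xj]; have [<-|ji] := eqVneq j i; [by left | right].
  by rewrite rmorph_prod /= (bigD1 j) //= (pP j ji).1 ?mul0r.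
- by apply: vanishing_prod => j /pP[].
Qed.

End Arrangement.

Lemma homog0_mpolyC (F : fieldType) (n : nat) (p : {mpoly F[n]}) :
  p \is 0.-homog -> p = (p@_0)%:MP.
Proof.
move=> ph; apply/mpolyP => m; rewrite mcoeffC.
have [<-|m0] := eqVneq 0%MM m; first by rewrite mulr1.
by rewrite mulr0 (dhomog_nemf_coeff ph) //= mdeg_eq0 eq_sym.
Qed.

Lemma card_ksubset n k : #|{: ksubset n k}| = 'C(n, k).
Proof.
by rewrite card_sub; have := card_draws 'I_n k; rewrite card_ord cardsE.
Qed.

(** * Generic arrangements *)

Section ConstantFields.
Variables (F : numFieldType) (n k : nat).

(** The field with constant coefficients [v]. *)
Definition const_field (v : ksubset n k -> F) : kvector_field F n k :=
  [ffun E => (v E)%:MP].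

Lemma const_field_homog v : kvf_homog 0 (const_field v).
Proof.
move=> E; rewrite ffunE -[v E]mulr1 mpolyCM mpolyC1 mul_mpolyC.
by rewrite rpredZ ?dhomog1.
Qed.

Lemma homog0_const_field (a : kvector_field F n k) :
  kvf_homog 0 a -> a = const_field (fun E => (a E : {mpoly F[n]})@_0).
Proof. by move=> a0; apply/ffunP => E; rewrite ffunE; exact: homog0_mpolyC. Qed.

Lemma plucker_form_const (L : 'M[F]_(k, n)) v :
  plucker_form L (const_field v) = (\sum_E v E * plucker L E)%:MP.
Proof.
rewrite /plucker_form raddf_sum; apply: eq_bigr => E _ /=.
by rewrite ffunE -mpolyCM mulrC.
Qed.

Lemma vanishing_const (U : {vspace 'rV[F]_n}) (c : F) :
  vanishing_ideal (vspace_set U) c%:MP <-> c = 0.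
Proof.
split=> [/(_ 0 (mem0v U))|-> x _]; last by rewrite mevalC.
by rewrite mevalC.
Qed.

End ConstantFields.

Section FreeArrangement.
Variables (F : numFieldType) (n k s : nat) (X : 'I_s -> {vspace 'rV[F]_n}).
Variable L : 'I_s -> 'M[F]_(k, n).
Hypothesis mlogP : forall i (a : kvector_field F n k),
  is_mlog (vspace_set (X i)) a <->
  vanishing_ideal (vspace_set (X i)) (plucker_form (L i) a).

(** The plucker forms of a generic arrangement are linearly independent; [b] is
    a basis of their common kernel on constant fields, [D] is dual to the forms
    and [Q] to [b]. *)
Lemma generic_dual_bases : (s <= 'C(n, k))%N -> generic k X ->
  exists (b : 'I_('C(n, k) - s) -> ksubset n k -> F)
         (D : 'I_s -> ksubset n k -> F)
         (Q : ksubset n k -> 'I_('C(n, k) - s) -> F),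
    [/\ forall i i', \sum_E D i E * plucker (L i') E = (i == i')%:R,
        forall E E', \sum_i plucker (L i) E * D i E' + \sum_j Q E j * b j E' =
                     (E == E')%:R,
        forall j j', \sum_E b j E * Q E j' = (j == j')%:R,
        forall i j, \sum_E D i E * Q E j = 0
      & forall j i, \sum_E b j E * plucker (L i) E = 0].
Proof.
move=> sN /(_ [set: 'I_s]%SET).
rewrite cardsT card_ord (minn_idPl sN) => /(_ erefl)[b [bfree bspan]].
have const_in v : (forall i, \sum_E v E * plucker (L i) E = 0) <->
    (forall i, i \in [set: 'I_s]%SET ->
       is_mlog (vspace_set (X i)) (const_field v)) /\
    kvf_homog 0 (const_field v).
  split=> [v0|[vi _] i].
    split=> [i _|]; last exact: const_field_homog.
    by apply/mlogP; rewrite plucker_form_const; apply/vanishing_const.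
  have /mlogP := vi i (finset.in_setT i).
  by rewrite plucker_form_const => /vanishing_const.
have b_in j : (forall i, i \in [set: 'I_s]%SET ->
    is_mlog (vspace_set (X i)) (b j)) /\ kvf_homog 0 (b j).
  apply/bspan; exists (fun j' => (j' == j)%:R).
  rewrite (bigD1 j) //= eqxx scale1r big1 ?addr0 // => j' /negbTE->.
  by rewrite mpolyC0 scale0r.
have bE j := homog0_const_field (b_in j).2.
pose bc j E := (b j E : {mpoly F[n]})@_0.
have bcE j : b j = const_field (bc j) by exact: bE.
have comb (q : 'I_('C(n, k) - s) -> F) : \sum_j (q j)%:MP *: b j =
    const_field (fun E => \sum_j q j * bc j E).
  apply/ffunP => E; rewrite sum_ffunE ffunE raddf_sum; apply: eq_bigr => j _ /=.
  by rewrite {1}bcE !ffunE mpolyCM.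
have bcal j i : \sum_E bc j E * plucker (L i) E = 0.
  by move: i; apply/const_in; rewrite -bcE.
have [||||D [Q [DA ADQB BQ DQ]]] :=
  @dual_bases F (ksubset n k) s ('C(n, k) - s) (fun i => plucker (L i)) bc.
- by rewrite card_ksubset subnKC.
- move=> q q0; apply: bfree; rewrite comb; apply/ffunP => E.
  by rewrite !ffunE q0 mpolyC0.
- move=> v /const_in/bspan[q]; rewrite comb => /ffunP qE; exists q => E.
  by have := qE E; rewrite !ffunE => /eqP; rewrite mpolyC_eq => /eqP.
- exact: bcal.
by exists bc, D, Q.
Qed.

End FreeArrangement.

Lemma in_ideal_ideal_gen (S : comNzRingType) (t : seq S) f :
  in_ideal t f <-> ideal_gen (nth 0 t) (size t) f.
Proof. by []. Qed.

Lemma regular_seq_upto (S : comNzRingType) (t : seq S) :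
  regular_seq t -> regular_upto (nth 0 t) (size t).
Proof.
have takeP i g : (i < size t)%N ->
    in_ideal (take i t) g <-> ideal_gen (nth 0 t) i g.
  move=> it; have szi := size_takel (ltnW it).
  split=> -[c ->]; exists c; rewrite szi; apply: eq_bigr => l _;
    by rewrite nth_take.
by move=> [reg _] i it g /(takeP _ _ it)/(reg i it)/(takeP _ _ it).
Qed.

(** Only the characteristic zero of the base field matters: a polynomial in one
    variable that vanishes at all the natural numbers is zero. *)
Theorem generic_arrangement_free (F : numFieldType) (n k s : nat)
    (X : 'I_s -> {vspace 'rV[F]_n}) (h : 'I_s -> k.-tuple {mpoly F[n]}) :
    (1 <= k)%N -> (1 <= s)%N ->
    subspace_arrangement k X -> (forall i, regular_seq (h i)) ->
    (forall i, defined_by (X i) (h i)) ->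
  (s <= 'C(n, k))%N -> generic k X -> mlog_free k (arrangement_set X).
Proof.
move=> k_gt0 s_gt0 X_arr h_reg X_def sN gen.
have [L LP] := choice (fun i => subspace_equations (X_arr.2 i)).
have LX i x := (LP i).1 x; have annX i := (LP i).2.
have [b [D [Q [DL LDQb bQ DQ bL]]]] :=
  generic_dual_bases (mlog_subspaceP LX annX) sN gen.
set c := ('C(n, k) - s)%N in b Q LDQb bQ DQ bL.
pose SF : comNzRingType := {mpoly F[n]}.
pose hs i := nth 0 (h i) : nat -> SF.
have idealP i f :
    vanishing_ideal (vspace_set (X i)) f <-> ideal_gen (hs i) k f.
  by rewrite (X_def i f) in_ideal_ideal_gen size_tuple.
pose M := mlog k (arrangement_set X).
(* The coordinates of a field in the basis formed by the [D i] and [b j]. *)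
pose phi_fun (m : M) : ({ffun 'I_s -> SF^o} * {ffun 'I_c -> SF^o})%type :=
  ([ffun i => plucker_form (L i) m],
   [ffun j => \sum_E (Q E j)%:MP * (mlog_val m E : SF)]).
have formP (w : ksubset n k -> F) r (m m' : kvector_field F n k) :
    \sum_E (w E)%:MP * ((r *: m + m') E : SF) =
    r * (\sum_E (w E)%:MP * (m E : SF)) + \sum_E (w E)%:MP * (m' E : SF).
  rewrite mulr_sumr -big_split; apply: eq_bigr => E _ /=.
  by rewrite !ffunE mulrDr mulrCA.
have phi_lin : linear phi_fun.
  by move=> r m m'; congr pair; apply/ffunP => i; rewrite !ffunE; exact: formP.
pose phi := mk_linear phi_lin.
have expand (a : kvector_field F n k) E' : (a E' : SF) =
    \sum_i plucker_form (L i) a * (D i E')%:MP +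
    \sum_j (\sum_E (Q E j)%:MP * (a E : SF)) * (b j E')%:MP.
  have -> : (a E' : SF) = \sum_E (a E : SF) * (E == E')%:R%:MP.
    rewrite (bigD1 E') //= eqxx mpolyC1 mulr1 big1 ?addr0 // => E /negbTE->.
    by rewrite mpolyC0 mulr0.
  under eq_bigr do rewrite -LDQb mpolyCD !raddf_sum mulrDr /=.
  rewrite big_split /=; congr (_ + _).
    under eq_bigr do rewrite mulr_sumr.
    rewrite exchange_big; apply: eq_bigr => i _; rewrite mulr_suml.
    by apply: eq_bigr => E _; rewrite mpolyCM mulrA [_ * (a E : SF)]mulrC.
  under eq_bigr do rewrite mulr_sumr.
  rewrite exchange_big; apply: eq_bigr => j _; rewrite mulr_suml.
  by apply: eq_bigr => E _; rewrite mpolyCM mulrA [_ * (a E : SF)]mulrC.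
have phi_inj m : phi m = 0 -> m = 0.
  case=> /ffunP m1 /ffunP m2; apply/val_inj/ffunP => E'.
  rewrite [LHS]expand [RHS]ffunE !big1 ?addr0 // => [j|i] _.
    by have := m2 j; rewrite !ffunE => ->; rewrite mul0r.
  by have := m1 i; rewrite !ffunE => ->; rewrite mul0r.
have phi_image w : (exists m, phi m = w) <->
    forall i, ideal_gen (hs i) k (w.1 i).
  split=> [[m <-] i|wI].
    rewrite /= ffunE; apply/idealP.
    apply: (mlog_arrangementP X_arr LX annX _).1.
    exact/asboolP/(mlog_valP m).
  pose a : kvector_field F n k := [ffun E =>
    \sum_i (w.1 i : SF) * (D i E)%:MP + \sum_j (w.2 j : SF) * (b j E)%:MP].
  have aE (q : ksubset n k -> F) : \sum_E (q E)%:MP * (a E : SF) =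
      \sum_i (w.1 i : SF) * (\sum_E D i E * q E)%:MP +
      \sum_j (w.2 j : SF) * (\sum_E b j E * q E)%:MP.
    under eq_bigr do rewrite ffunE mulrDr !mulr_sumr.
    rewrite big_split /=; congr (_ + _); rewrite exchange_big /=;
      apply: eq_bigr => i _; rewrite raddf_sum mulr_sumr; apply: eq_bigr => E _;
      by rewrite /= mpolyCM mulrCA [(q E)%:MP * _]mulrC.
  have a1 i : plucker_form (L i) a = w.1 i.
    rewrite [LHS]aE (bigD1 i) //= DL eqxx mulr1 big1 => [|i' /negbTE i'i].
      by rewrite addr0 big1 ?addr0 // => j _; rewrite bL mpolyC0 mulr0.
    by rewrite DL i'i mpolyC0 mulr0.
  have a2 j : \sum_E (Q E j)%:MP * (a E : SF) = w.2 j.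
    rewrite aE big1 => [|i _]; last by rewrite DQ mpolyC0 mulr0.
    rewrite add0r (bigD1 j) //= bQ eqxx mulr1 big1 ?addr0 // => j' /negbTE j'j.
    by rewrite bQ j'j mpolyC0 mulr0.
  have aM : a \in mlog_pred (arrangement_set X).
    apply/asboolP/(mlog_arrangementP X_arr LX annX) => i.
    by rewrite a1; apply/idealP.
  exists (MLog aM); rewrite [RHS]surjective_pairing.
  by congr pair; apply/ffunP => i; rewrite ffunE ?a1 ?a2.
apply: (sum_ideals_proj_dim phi_inj phi_image _ k_gt0 (i0 := Ordinal s_gt0)).
  by move=> i; have := regular_seq_upto (h_reg i); rewrite size_tuple.
have [_] := h_reg (Ordinal s_gt0).
by rewrite /= in_ideal_ideal_gen size_tuple.
Qed.

Theorem corollary3p9 (R : realType) (n k s : nat)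
    (X : 'I_s -> {vspace 'rV[R[i]]_n})
    (h : 'I_s -> k.-tuple {mpoly R[i][n]})
    (n_ge1 : (1 <= n)%N) (k_ge1 : (1 <= k)%N) (s_ge1 : (1 <= s)%N)
    (X_arr : subspace_arrangement k X)
    (h_reg : forall i, regular_seq (h i))
    (X_def : forall i, defined_by (X i) (h i)) :
  (s <= 'C(n, k))%N -> generic k X -> mlog_free k (arrangement_set X).
Proof.
exact: generic_arrangement_free k_ge1 s_ge1 X_arr h_reg X_def.
Qed.
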